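(* Let $\bm\sigma=\sigma_1\bm e_1+\dots+\sigma_r\bm e_r\in\mathbb{Z}^r$ be a changemaker vector with $\sigma_r\ge 3$ and $n=\bm\sigma\cdot\bm\sigma$, and let $L=\langle\bm\sigma\rangle^\perp\subseteq\mathbb{Z}^r$ be the corresponding $n$-changemaker lattice. If $L$ admits an obtuse superbase, then \[ n\le 4+\frac32\sum_{i=1}^r\sigma_i(\sigma_i-1). \]
   Context: $\mathbb{Z}^r$ carries the standard Euclidean pairing with orthonormal basis $\bm e_1,\dots,\bm e_r$. A changemaker vector is $\bm\sigma=\sum\sigma_i\bm e_i$ with $\sigma_1=1$ and $\sigma_{i-1}\le\sigma_i\le 1+\sigma_1+\dots+\sigma_{i-1}$ for $i=2,\dots,r$. For an integral lattice $L$ of rank $k$ (free abelian group with symmetric positive definite integral bilinear form), an obtuse superbase is a set $\{v_0,\dots,v_k\}\subseteq L$ that spans $L$, satisfies $v_i\cdot v_j\le0$ for $i\ne j$, and $v_0+\dots+v_k=0$. *)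

(* Defs.v *)
From HB Require Import structures.
From mathcomp Require Import all_boot all_order all_algebra.
Set Implicit Arguments. Unset Strict Implicit. Unset Printing Implicit Defensive.
Import Order.TTheory GRing.Theory Num.Theory.
Local Open Scope ring_scope.

Definition dotZ (r : nat) (u v : 'rV[int]_r) : int := \sum_(i < r) u 0 i * v 0 i.

(* changemaker vector (0-based: index 0 is sigma_1):
   sigma_1 = 1 and sigma_{i-1} <= sigma_i <= 1 + sigma_1 + ... + sigma_{i-1} *)
Definition changemaker (r : nat) (s : 'rV[int]_r) : Prop :=
  (0 < r)%N /\
  (forall i : 'I_r, val i = 0%N -> s 0 i = 1) /\
  (forall i j : 'I_r, val j = (val i).+1 ->
     s 0 i <= s 0 j /\ s 0 j <= 1 + \sum_(k < r | (val k <= val i)%N) s 0 k).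

Definition cm_lattice (r : nat) (s : 'rV[int]_r) (x : 'rV[int]_r) : Prop :=
  dotZ x s = 0.

(* an obtuse superbase {v_0,...,v_k} of a lattice L of rank k *)
Definition obtuse_superbase (r : nat) (L : 'rV[int]_r -> Prop) (k : nat)
  (v : 'I_k.+1 -> 'rV[int]_r) : Prop :=
  (forall i, L (v i)) /\
  (forall x, L x -> exists c : 'I_k.+1 -> int, x = \sum_(i < k.+1) c i *: v i) /\
  (forall i j, i != j -> dotZ (v i) (v j) <= 0) /\
  (\sum_(i < k.+1) v i = 0).

Definition admits_obtuse_superbase (r : nat) (L : 'rV[int]_r -> Prop) (k : nat) : Prop :=
  exists v : 'I_k.+1 -> 'rV[int]_r, @obtuse_superbase r L k v.

(* Main.v *)
(* The claim amounts to 0 <= 8 + sum sigma_i (sigma_i - 3), where only the entries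
   1 and 2 contribute negatively (-2 each), so it suffices to bound their number
   m + p in terms of a single entry s = sigma_t >= 3.

   An obtuse superbase v_0, ..., v_k turns L into the cut lattice of the multigraph
   with - v_i . v_j edges between i and j: a vector sum c_i v_i becomes the tension
   c_i - c_j, and its norm is the sum of the squared tensions.  Superlevel sets of c
   peel off, conformally, cuts with tensions in {0, 1, -1}.  Let I be the set of
   indices where sigma takes a given value, |I| >= 2.  The roots e_i - e_j with i, j
   in I are the 2-edge cuts inside one series class of |I| edges, and on these edges
   x in L takes, up to signs, the values x_i + b(x) for an additive b.  A cut
   meeting the class in a single edge has at least two more edges, whence
     sum_I (x_i + b(x))^2 + 2 |sum_I (x_i + b(x))| <= x . x.
   Applied to relations such as e_t - sum_Q e_j with sigma_t = sum_Q sigma_j, for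
   the values 1 and 2, this bounds m and p. *)
Require Import Defs.
From HB Require Import structures.
From mathcomp Require Import all_boot all_order all_algebra.
From mathcomp Require Import zify ring lra.
Set Implicit Arguments. Unset Strict Implicit. Unset Printing Implicit Defensive.
Import Order.TTheory GRing.Theory Num.Theory.
Local Open Scope ring_scope.

(** * Integer squares, finite sums and numerical estimates for the shift *)

Lemma int_sqr_lt4 (z : int) : z != 0 -> z * z < 4 -> z = 1 \/ z = -1.
Proof.
move=> z0 z4; have : -2 < z by nia.
have : z < 2 by nia.
by lia.
Qed.

Lemma int_sqr_eq1 (z : int) : z * z = 1 -> z = 1 \/ z = -1.
Proof. by move=> z1; apply: int_sqr_lt4; [case: eqP z1 => // -> | rewrite z1]. Qed.

Lemma sum_sqr_eq1 (T : finType) (P : pred T) (g : T -> int) :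
  \sum_(i | P i) g i * g i = 1 ->
  exists a, [/\ P a, g a * g a = 1 & forall i, P i -> i != a -> g i = 0].
Proof.
move=> H.
have [a Pa ga] : exists2 a, P a & g a != 0.
  have [/exists_inP[a Pa ga]|/exists_inPn Hn] := boolP [exists (i | P i), g i != 0].
    by exists a.
  by move: H; rewrite big1 // => i Pi; move/negPn/eqP: (Hn i Pi) => ->.
move: H; rewrite (bigD1 a) //=; set S := (\sum_(i | _) _) => H.
have S0 : 0 <= S by apply: sumr_ge0 => i _; rewrite -expr2 sqr_ge0.
have ga1 : g a * g a = 1 by have [||->|->] := @int_sqr_lt4 (g a); lia.
exists a; split=> // i Pi ia.
have {}S0 : S = 0 by lia.
move/eqP: S0; rewrite psumr_eq0 => [/allP Hs | j _]; last by rewrite -expr2 sqr_ge0.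
by move: (Hs i (mem_index_enum i)); rewrite Pi ia /= mulf_eq0 orbb => /eqP.
Qed.

Lemma sum_sqr_eq2 (T : finType) (g : T -> int) :
  \sum_i g i * g i = 2 ->
  exists a b, [/\ a != b, g a * g a = 1, g b * g b = 1 &
    forall i, i != a -> i != b -> g i = 0].
Proof.
move=> H.
have [a ga] : exists a, g a != 0.
  have [/existsP//|/existsPn Hn] := boolP [exists a, g a != 0].
  by move: H; rewrite big1 // => i _; move/negPn/eqP: (Hn i) => ->.
move: H; rewrite (bigD1 a) //=; set S := (\sum_(i | _) _) => H.
have S0 : 0 <= S by apply: sumr_ge0 => i _; rewrite -expr2 sqr_ge0.
have ga1 : g a * g a = 1 by have [||->|->] := @int_sqr_lt4 (g a); lia.
have S1 : S = 1 by lia.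
have [b [ba gb Hb]] := sum_sqr_eq1 S1.
by exists a, b; split=> //; rewrite eq_sym.
Qed.

Lemma sum_mem_subset (T : finType) (C Q : {set T}) (h : bool -> int) :
  Q \subset C -> \sum_(j in C) h (j \in Q) =
    #|Q|%:Z * h true + (#|C|%:Z - #|Q|%:Z) * h false.
Proof.
move=> QC; rewrite (bigID (mem Q)) /=; congr (_ + _).
  rewrite (eq_big (mem Q) (fun => h true)) => [|j|j /andP[_ ->]//].
    by rewrite sumr_const -mulr_natl natz.
  by apply/andP/idP => [[]|jQ]//; split=> //; apply: (subsetP QC).
rewrite (eq_big (mem (C :\: Q)) (fun => h false)) => [|j|j /andP[_ /negbTE->]//].
  have := cardsID Q C; rewrite (setIidPr QC) => <-.
  by rewrite sumr_const PoszD addrC addKr -mulr_natl natz.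
by rewrite !inE andbC.
Qed.

Lemma exists_subset_card (T : finType) (A : {set T}) (k : nat) :
  (k <= #|A|)%N -> exists2 Q : {set T}, Q \subset A & #|Q| = k.
Proof.
move=> kA; exists [set x in take k (enum A)].
  by apply/subsetP => x; rewrite inE => /mem_take; rewrite mem_enum.
by rewrite cardsE (card_uniqP _) ?take_uniq ?enum_uniq // size_takel -?cardE.
Qed.

(** A shift [b <= 0] makes the left side at least [3 * q > N]; [b = 1] gives exactly the claim, and
    [b >= 2] gives more. *)
Lemma pattern_bound (q n b N : int) : 1 <= q <= n -> N < 3 * q ->
  q * ((b - 1) * (b - 1)) + (n - q) * (b * b) + 2 * `|n * b - q| <= N ->
  3 * n <= 3 * q + N.
Proof.
move=> /andP[q1 qn] Nq; have [b1|b1|->] := ltgtP b 1; last by lia.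
  have : 0 <= (n - q) * (b * b) by rewrite mulr_ge0 ?subr_ge0 // -expr2 sqr_ge0.
  have : q * 1 <= q * ((b - 1) * (b - 1)) by rewrite ler_wpM2l //; [lia | nia].
  have : 0 <= n * (- b) by rewrite mulr_ge0 //; lia.
  by lia.
have : q * 1 <= q * ((b - 1) * (b - 1)) by rewrite ler_wpM2l //; [lia | nia].
have : (n - q) * 4 <= (n - q) * (b * b) by rewrite ler_wpM2l ?subr_ge0 //; nia.
have : n * 2 <= n * b by rewrite ler_wpM2l //; lia.
by lia.
Qed.

(** The squares are nonnegative, so [|3 * b - 1| <= 1], which leaves a single integer. *)
Lemma shift3_one (b : int) :
  1 * ((b - 1) * (b - 1)) + (3 - 1) * (b * b) + 2 * `|3 * b - 1| <= 1 + 2 ->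
  b = 0.
Proof.
have : 0 <= (b - 1) * (b - 1) by rewrite -expr2 sqr_ge0.
have : 0 <= b * b by rewrite -expr2 sqr_ge0.
by move: (b * b) ((b - 1) * (b - 1)) => A B; lia.
Qed.

Lemma shift3_two (b : int) :
  2 * ((b - 1) * (b - 1)) + (3 - 2) * (b * b) + 2 * `|3 * b - 2| <= 1 + 2 ->
  b = 1.
Proof.
have : 0 <= (b - 1) * (b - 1) by rewrite -expr2 sqr_ge0.
have : 0 <= b * b by rewrite -expr2 sqr_ge0.
by move: (b * b) ((b - 1) * (b - 1)) => A B; lia.
Qed.

(** * The Euclidean pairing on integer vectors *)

Section Dot.
Variable r : nat.
Implicit Types u v w : 'rV[int]_r.

Lemma dotZC u v : dotZ u v = dotZ v u.
Proof. by apply: eq_bigr => i _; rewrite mulrC. Qed.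

Lemma dotZDl u v w : dotZ (u + v) w = dotZ u w + dotZ v w.
Proof. by rewrite -big_split; apply: eq_bigr => i _; rewrite mxE mulrDl. Qed.

Lemma dotZNl u v : dotZ (- u) v = - dotZ u v.
Proof. by rewrite -sumrN; apply: eq_bigr => i _; rewrite mxE mulNr. Qed.

Lemma dotZBl u v w : dotZ (u - v) w = dotZ u w - dotZ v w.
Proof. by rewrite dotZDl dotZNl. Qed.

Lemma dotZZl a u v : dotZ (a *: u) v = a * dotZ u v.
Proof. by rewrite mulr_sumr; apply: eq_bigr => i _; rewrite mxE mulrA. Qed.

Lemma dotZDr u v w : dotZ w (u + v) = dotZ w u + dotZ w v.
Proof. by rewrite dotZC dotZDl !(dotZC w). Qed.

Lemma dotZNr u v : dotZ v (- u) = - dotZ v u.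
Proof. by rewrite dotZC dotZNl !(dotZC v). Qed.

Lemma dotZBr u v w : dotZ w (u - v) = dotZ w u - dotZ w v.
Proof. by rewrite dotZDr dotZNr. Qed.

Lemma dotZZr a u v : dotZ v (a *: u) = a * dotZ v u.
Proof. by rewrite dotZC dotZZl (dotZC v). Qed.

Lemma dotZ_suml (I : finType) (P : pred I) (F : I -> 'rV[int]_r) v :
  dotZ (\sum_(i | P i) F i) v = \sum_(i | P i) dotZ (F i) v.
Proof.
rewrite /dotZ exchange_big; apply: eq_bigr => i _.
by rewrite summxE mulr_suml.
Qed.

Lemma dotZ_sumr (I : finType) (P : pred I) (F : I -> 'rV[int]_r) v :
  dotZ v (\sum_(i | P i) F i) = \sum_(i | P i) dotZ v (F i).
Proof. by rewrite dotZC dotZ_suml; apply: eq_bigr => i _; rewrite dotZC. Qed.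

Definition unitv (i : 'I_r) : 'rV[int]_r := delta_mx 0 i.

Lemma unitvE i j : unitv i 0 j = (i == j)%:R.
Proof. by rewrite mxE eqxx eq_sym. Qed.

Lemma unitvBE i k j : (unitv i - unitv k) 0 j = (i == j)%:R - (k == j)%:R.
Proof. by rewrite -!unitvE mxE [X in _ + X]mxE. Qed.

Lemma dotZ_unitr u i : dotZ u (unitv i) = u 0 i.
Proof.
rewrite /dotZ (bigD1 i) //= big1 ?addr0 => [|j ji]; rewrite unitvE ?eqxx ?mulr1 //.
by rewrite eq_sym (negbTE ji) mulr0.
Qed.

Lemma dotZ_unitl u i : dotZ (unitv i) u = u 0 i.
Proof. by rewrite dotZC dotZ_unitr. Qed.

Lemma dotZ_unit i j : dotZ (unitv i) (unitv j) = (i == j)%:R.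
Proof. by rewrite dotZ_unitr unitvE. Qed.

Definition chi (Q : {set 'I_r}) : 'rV[int]_r := \row_j (j \in Q)%:R.

Lemma chiE Q j : chi Q 0 j = (j \in Q)%:R.
Proof. by rewrite mxE. Qed.

Lemma dotZ_chil Q x : dotZ (chi Q) x = \sum_(j in Q) x 0 j.
Proof.
rewrite /dotZ [RHS]big_mkcond; apply: eq_bigr => j _; rewrite chiE.
by case: ifP; rewrite ?mul1r ?mul0r.
Qed.

Lemma chi_set2 i j : i != j -> chi [set i; j] = unitv i + unitv j.
Proof.
move=> ij; apply/rowP => k; rewrite mxE [RHS]mxE !unitvE !inE !(eq_sym k).
have [ik|ik] := eqVneq i k; have [jk|jk] := eqVneq j k; rewrite ?addr0 ?add0r //.
by rewrite ik jk eqxx in ij.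
Qed.

End Dot.

(** * Cut lattices orthogonal to a positive vector *)

Section Network.
(** Abstract form of the graph: [M] is the group of potentials, [vec] maps it onto the lattice, and
    [phi e] is the tension on the edge [e]. In [threshold], [u] is the cut of a superlevel set,
    conformal to [c]. *)
Variables (M : zmodType) (r : nat) (sigma : 'rV[int]_r) (E : finType).
Variables (vec : {additive M -> 'rV[int]_r}) (phi : E -> {additive M -> int}).
Hypothesis sigma_gt0 : forall i, 0 < sigma 0 i.
Hypothesis vec_orth : forall c, dotZ (vec c) sigma = 0.
Hypothesis vec_onto : forall x, dotZ x sigma = 0 -> exists c, vec c = x.
Hypothesis gram : forall c d, dotZ (vec c) (vec d) = \sum_e phi e c * phi e d.
Hypothesis threshold : forall f c, 0 < phi f c -> exists2 u, phi f u = 1 &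
  forall e, [\/ phi e u = 0, phi e u = 1 /\ 0 < phi e c
    | phi e u = -1 /\ phi e c < 0].

Local Notation "<< c , d >>" := (dotZ (vec c) (vec d)) (format "<< c ,  d >>").

(** A vector of norm 1 is a signed unit vector, which cannot be orthogonal to a positive [sigma]. *)
Lemma norm_neq1 c : <<c, c>> <> 1.
Proof.
move=> /sum_sqr_eq1[a [_ ga Ha]].
have := vec_orth c; rewrite /dotZ (bigD1 a) //= big1 => [|i ia]; last first.
  by rewrite Ha ?mul0r.
by have := sigma_gt0 a; nia.
Qed.

Lemma norm2_root c : <<c, c>> = 2 ->
  exists a b, [/\ a != b, sigma 0 a = sigma 0 b & vec c = unitv a - unitv b].
Proof.
move=> /sum_sqr_eq2[a [b [ab ga gb Hab]]].
have H : vec c 0 a * sigma 0 a + vec c 0 b * sigma 0 b = 0.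
  have := vec_orth c; rewrite /dotZ (bigD1 a) //= (bigD1 b) /=; last by rewrite eq_sym.
  by rewrite big1 ?addr0 // => i /andP[ia ib]; rewrite Hab ?mul0r.
have sa := sigma_gt0 a; have sb := sigma_gt0 b.
have vecE x y : x != y -> vec c 0 x = 1 -> vec c 0 y = -1 ->
    (forall i, i != x -> i != y -> vec c 0 i = 0) -> vec c = unitv x - unitv y.
  move=> xy hx hy Hxy; apply/rowP => i; rewrite unitvBE.
  have [<-|xi] := eqVneq x i; first by rewrite eq_sym (negbTE xy) subr0.
  have [<-|yi] := eqVneq y i; first by rewrite sub0r.
  by rewrite subr0 Hxy // eq_sym.
have [va|va] := int_sqr_eq1 ga.
  have vb : vec c 0 b = -1 by have [vb|//] := int_sqr_eq1 gb; rewrite va vb in H; lia.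
  exists a, b; split=> //; first by rewrite va vb in H; lia.
  exact: vecE.
have vb : vec c 0 b = 1 by have [//|vb] := int_sqr_eq1 gb; rewrite va vb in H; lia.
exists b, a; split=> //; [by rewrite eq_sym|by rewrite va vb in H; lia|].
by apply: vecE => // [|i ib ia]; [rewrite eq_sym | apply: Hab].
Qed.

Lemma phi_sqr_le f c : phi f c * phi f c <= <<c, c>>.
Proof.
rewrite gram (bigD1 f) //= lerDl; apply: sumr_ge0 => e _.
by rewrite -expr2 sqr_ge0.
Qed.

(** A tension of 2 on [f] would exhaust the norm 4, so [c] would be supported on [f] alone, and the
    threshold cut would have norm 1. *)
Lemma norm4_phi_le1 f c : <<c, c>> = 4 -> `|phi f c| <= 1.
Proof.
wlog: c / 0 < phi f c => [hw H|fc H].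
  have [fc|fc|<- //] := ltgtP 0 (phi f c); first exact: hw.
  rewrite -normrN -raddfN; apply: hw; first by rewrite raddfN oppr_gt0.
  by rewrite raddfN dotZNl dotZNr opprK.
have := phi_sqr_le f c; rewrite H => fle.
rewrite leNgt; apply/negP => fgt.
have f2 : phi f c = 2 by nia.
have e0 e : e != f -> phi e c = 0.
  move=> ef; have := gram c c.
  rewrite (bigD1 f) //= (bigD1 e) //= H f2.
  set S := \sum_(i | _) _.
  have : 0 <= S by apply: sumr_ge0 => i _; rewrite -expr2 sqr_ge0.
  by nia.
have [u fu Hu] := threshold fc.
apply: (@norm_neq1 u); rewrite gram (bigD1 f) //= fu big1 ?addr0 // => e ef.
by case: (Hu e) => [->|[_]|[_]]; rewrite ?mul0r // e0.
Qed.

(** * Roots inside one level of [sigma] and their series class of edges *)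

Section Class.
Variables (i0 : 'I_r) (alpha : 'I_r -> M).
Let I := [pred j | (sigma 0 j == sigma 0 i0) && (j != i0)].
Hypothesis alphaE : forall j, j \in I -> vec (alpha j) = unitv i0 - unitv j.

Lemma norm_alpha j : j \in I -> <<alpha j, alpha j>> = 2.
Proof.
move=> Ij; rewrite alphaE // dotZBl !dotZBr !dotZ_unitr !unitvE !eqxx.
by case/andP: Ij => _ /negbTE; rewrite (eq_sym i0) => ->.
Qed.

Lemma dot_alpha j k : j \in I -> k \in I -> j != k -> <<alpha j, alpha k>> = 1.
Proof.
move=> Ij Ik jk; rewrite !alphaE // dotZBl !dotZBr !dotZ_unitr !unitvE !eqxx.
case/andP: Ij => _ /negbTE ->; case/andP: Ik => _ /negbTE; rewrite (eq_sym i0) => ->.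
by rewrite (negbTE jk).
Qed.

Lemma phi_alpha_le1 f j : j \in I -> `|phi f (alpha j)| <= 1.
Proof. by move=> Ij; have := phi_sqr_le f (alpha j); rewrite norm_alpha //; nia. Qed.

(* Otherwise three roots [alpha j] would pairwise share the edges of a triple,
   and [alpha j1 + alpha j2 - alpha j] would be twice a single edge. *)
Lemma common_edge j1 : j1 \in I -> exists f eta,
  eta * eta = 1 /\ forall j, j \in I -> phi f (alpha j) = eta.
Proof.
move=> I1.
have [/existsP[j2 /andP[I2 j12]]|/existsPn one] :=
    boolP [exists j, (j \in I) && (j != j1)]; last first.
  have := norm_alpha I1; rewrite gram => /sum_sqr_eq2[f [_ [_ f1 _ _]]].
  exists f, (phi f (alpha j1)); split=> // j Ij.
  by have := one j; rewrite Ij /= => /negPn/eqP->.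
(* The pairing of two distinct roots is 1, so some edge carries both with the same sign. *)
have [f fpos] : exists f, 0 < phi f (alpha j1) * phi f (alpha j2).
  have [/existsP//|/existsPn H] :=
    boolP [exists f, 0 < phi f (alpha j1) * phi f (alpha j2)].
  have := dot_alpha I2 I1 j12; rewrite dotZC gram => H1.
  have : \sum_e phi e (alpha j1) * phi e (alpha j2) <= 0.
    by apply: sumr_le0 => e _; rewrite leNgt.
  by rewrite H1.
have b1 := phi_alpha_le1 f I1; have b2 := phi_alpha_le1 f I2.
have e12 : phi f (alpha j2) = phi f (alpha j1) by nia.
have ee : phi f (alpha j1) * phi f (alpha j1) = 1 by nia.
exists f, (phi f (alpha j1)); split=> // j Ij.
have [->//|jj1] := eqVneq j j1; have [->//|jj2] := eqVneq j j2.
(* The norm is 6 + 2 - 2 - 2 = 4. Any other value of [alpha j] on [f] would give this combination a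
   tension of size at least 2 there. *)
have : `|phi f (alpha j1 + alpha j2 - alpha j)| <= 1.
  apply: norm4_phi_le1; rewrite !raddfB !raddfD /= !(dotZBl, dotZBr, dotZDl, dotZDr).
  rewrite !norm_alpha // (dot_alpha I2 I1) // (dot_alpha Ij I1) //.
  by rewrite (dot_alpha Ij I2) // dotZC !dot_alpha // 1?eq_sym.
rewrite raddfB raddfD /= e12; have := phi_alpha_le1 f Ij.
by set z := phi f (alpha j); have [->|->] := int_sqr_eq1 ee; lia.
Qed.

Section CommonEdge.
Variables (f : E) (eta : int) (j1 : 'I_r).
Hypotheses (I1 : j1 \in I) (eta1 : eta * eta = 1).
Hypothesis alpha_f : forall j, j \in I -> phi f (alpha j) = eta.

(* [X] vanishes on the series class of [f], except possibly on [f] itself. *)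
Let off_alpha X := forall j e, j \in I -> e != f -> phi e (alpha j) != 0 -> phi e X = 0.

Lemma alpha_other_edge j : j \in I -> exists2 e, e != f & phi e (alpha j) != 0 /\
  forall e', e' != f -> e' != e -> phi e' (alpha j) = 0.
Proof.
move=> Ij; have := norm_alpha Ij; rewrite gram (bigD1 f) //= alpha_f // eta1.
move=> H; have {H} : \sum_(e | e != f) phi e (alpha j) * phi e (alpha j) = 1.
  by apply: (addrI 1); rewrite H.
move=> /sum_sqr_eq1[e [ef e1 He]]; exists e => //; split=> //.
by apply/eqP => e0; rewrite e0 in e1.
Qed.

(** Each [alpha j] lives on [f] and one further edge. The pairing with [X] is [eta * phi f X] plus
    the contribution of that edge, which vanishes exactly when [X] does there. *)
Lemma off_alphaP X :
  off_alpha X <-> forall j, j \in I -> <<alpha j, X>> = eta * phi f X.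
Proof.
split=> [H j Ij|H j e Ij ef e0].
  rewrite gram (bigD1 f) //= alpha_f // big1 ?addr0 // => e ef.
  have [->|e0] := eqVneq (phi e (alpha j)) 0; first by rewrite mul0r.
  by rewrite (H j e) // mulr0.
have [g gf [g0 Hg]] := alpha_other_edge Ij.
have := H j Ij; rewrite gram (bigD1 f) //= alpha_f // (bigD1 g) //=.
rewrite big1 ?addr0 => [|e' /andP[e'f e'g]]; last by rewrite Hg ?mul0r.
have [<-|eg] := eqVneq e g; last by rewrite Hg ?eqxx in e0.
by rewrite -[RHS]addr0 => /addrI/eqP; rewrite mulf_eq0 (negbTE e0) => /eqP.
Qed.

(** Otherwise [u] is a root [e_a - e_b] pairing to [eta] with every [alpha j], so [a] and [b] lie in
    the level. If one of them is [i0], some pairing is 2 or -2; if not, [alpha a] and [alpha b] give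
    opposite signs. *)
Lemma off_alpha_norm_neq2 u : off_alpha u -> phi f u = 1 -> <<u, u>> <> 2.
Proof.
move=> /off_alphaP Hu fu /norm2_root[a [b [ab sab Eu]]].
have {}Hu j : j \in I -> (i0 == a)%:R - (i0 == b)%:R - (j == a)%:R + (j == b)%:R = eta.
  move=> Ij; have := Hu j Ij; rewrite fu mulr1 => <-.
  rewrite alphaE // dotZBl !dotZ_unitl Eu !unitvBE !(eq_sym _ i0) !(eq_sym _ j).
  by ring.
have sa : sigma 0 a = sigma 0 i0.
  have := Hu _ I1; have /andP[/eqP s1 _] := I1.
  have [->//|_] := eqVneq i0 a; have [->//|_] := eqVneq i0 b.
  have [<-//|_] := eqVneq j1 a; have [jb|_] := eqVneq j1 b.
    by rewrite sab -jb.
  by move=> e0; move: eta1; rewrite -e0.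
have Ia : a != i0 -> a \in I by rewrite inE sa eqxx.
have Ib : b != i0 -> b \in I by rewrite inE -sab sa eqxx.
have [ai|ai] := eqVneq a i0.
  rewrite ai eq_sym in ab; have := Hu b (Ib ab).
  rewrite ai !eqxx (eq_sym i0) (negbTE ab) => e2; move: eta1; rewrite -e2.
  by lia.
have [bi|bi] := eqVneq b i0.
  have := Hu a (Ia ai); rewrite bi !eqxx eq_sym (negbTE ai) => e2.
  by move: eta1; rewrite -e2.
have := Hu a (Ia ai); have := Hu b (Ib bi).
rewrite !eqxx !(eq_sym i0) (negbTE ai) (negbTE bi) (eq_sym b) (negbTE ab).
by lia.
Qed.

(** Threshold cuts are peeled off one at a time. By conformality each cut vanishes wherever [X]
    does, and absolute tensions add up. *)
Lemma off_alpha_flow X : off_alpha X ->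
  2 * `|phi f X| <= \sum_(e | e != f) `|phi e X|.
Proof.
have [k] := ubnP `|phi f X|%N; elim: k X => // k IH X.
wlog: X / 0 < phi f X => [hw Hk QX|fX].
  have [fX|fX|<-] := ltgtP 0 (phi f X); first exact: hw.
    rewrite -normrN -raddfN (eq_bigr (fun e => `|phi e (- X)|)) => [|e _].
      apply: hw; rewrite ?raddfN ?oppr_gt0 //= ?abszN // => j e Ij ef e0.
      by rewrite raddfN /= (QX j) ?oppr0.
    by rewrite raddfN normrN.
  by rewrite mulr0; apply: sumr_ge0.
move=> Hk QX; have [u fu Hu] := threshold fX.
have Qu : off_alpha u.
  move=> j e Ij ef e0; have := QX j e Ij ef e0 => X0.
  by case: (Hu e) => [//|[_]|[_]]; rewrite X0.
(* The norm of the cut is 1 plus this sum, and it is neither 1 nor 2. *)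
have le2 : 2 <= \sum_(e | e != f) `|phi e u|.
  have := off_alpha_norm_neq2 Qu fu; have := @norm_neq1 u.
  rewrite gram (bigD1 f) //= fu.
  rewrite (eq_bigr (fun e => `|phi e u|)) => [|e _]; last first.
    by case: (Hu e) => [->|[-> _]|[-> _]].
  have : 0 <= \sum_(e | e != f) `|phi e u| by apply: sumr_ge0.
  by set S := \sum_(e | _) _; lia.
rewrite (eq_bigr (fun e => `|phi e u| + `|phi e (X - u)|)) => [|e _]; last first.
  by rewrite raddfB /=; case: (Hu e) => [->|[->]|[->]]; move: (phi e X) => x; lia.
have := IH (X - u); rewrite big_split raddfB /= fu => {}IH.
have : 2 * `|phi f X - 1| <= \sum_(e | e != f) `|phi e (X - u)|.
  apply: IH; first by move: (phi f X) fX Hk => z; lia.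
  by move=> j e Ij ef e0; rewrite raddfB /= (QX j) // (Qu j) // subr0.
move: le2 fX; set S := \sum_(e | _) _; set S' := \sum_(e | _) _.
by move: (phi f X) => z; lia.
Qed.

End CommonEdge.

End Class.

(* With [b c] chosen so that [f] carries [eta * (x_i0 + b c)], adding the roots
   [alpha j] with multiplicity [x_j + b c] moves the whole series class onto [f]. *)
Lemma class_estimate (i0 j1 : 'I_r) : sigma 0 j1 = sigma 0 i0 -> j1 != i0 ->
  exists2 b : M -> int, forall c d, b (c - d) = b c - b d &
  forall c, \sum_(j | sigma 0 j == sigma 0 i0)
      (vec c 0 j + b c) * (vec c 0 j + b c)
    + 2 * `|\sum_(j | sigma 0 j == sigma 0 i0) (vec c 0 j + b c)| <= <<c, c>>.
Proof.
move=> s1 ij1; pose I := [pred j | (sigma 0 j == sigma 0 i0) && (j != i0)].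
have I1 : j1 \in I by rewrite inE s1 eqxx.
have /fin_all_exists[alpha alphaE] (j : 'I_r) :
    exists c, j \in I -> vec c = unitv i0 - unitv j.
  have [/andP[/eqP sj _]|_] := boolP (j \in I); last by exists 0.
  have [|c cE] := vec_onto (x := unitv i0 - unitv j); last by exists c.
  by rewrite dotZBl !dotZ_unitl sj subrr.
have [f [eta [eta1 alpha_f]]] := common_edge alphaE I1.
pose b c := eta * phi f c - vec c 0 i0.
exists b => [c d|c]; first by rewrite /b !raddfB /= !mxE; ring.
rewrite (bigD1 i0) //= [X in 2 * `|X|](bigD1 i0) //=.
set y0 := vec c 0 i0 + b c; pose y j := vec c 0 j + b c.
have y0E : y0 = eta * phi f c by rewrite /y0 /b addrC subrK.
set T := \sum_(j | _) (_ + _); pose X := c + \sum_(j | j \in I) alpha j *~ y j.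
have TE : T = \sum_(j | j \in I) y j by [].
have vecXE : vec X = vec c + \sum_(j | j \in I) y j *: (unitv i0 - unitv j).
  rewrite raddfD raddf_sum /=; congr (_ + _); apply: eq_bigr => j Ij.
  by rewrite raddfMz /= alphaE // -scaler_int intz.
have phiX : phi f X = eta * (y0 + T).
  rewrite y0E mulrDr mulrA eta1 mul1r raddfD raddf_sum /= TE mulr_sumr.
  congr (_ + _); apply: eq_bigr => j Ij.
  by rewrite raddfMz /= alpha_f // -mulrzr intz.
pose Z := \sum_(j | j \in I) y j *: (unitv i0 - unitv j).
have dotZE v : dotZ v Z = \sum_(j | j \in I) y j * (v 0 i0 - v 0 j).
  by rewrite dotZ_sumr; apply: eq_bigr => j _; rewrite dotZZr dotZBr !dotZ_unitr.
have Zi0 : Z 0 i0 = T.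
  rewrite summxE TE; apply: eq_bigr => j /andP[_ /negbTE ji].
  by rewrite mxE unitvBE eqxx ji subr0 mulr1.
have Zj k : k \in I -> Z 0 k = - y k.
  move=> Ik; rewrite summxE (bigD1 k) //= big1 ?addr0 => [|j /andP[_ /negbTE jk]].
    case/andP: Ik => _ /negbTE ki.
    by rewrite mxE unitvBE eqxx eq_sym ki sub0r mulrN1.
  case/andP: Ik => _ /negbTE ki.
  by rewrite mxE unitvBE jk eq_sym ki subrr mulr0.
(* By the pairing criterion it suffices that [X] pairs to [y0 + T] with every [alpha j]. *)
have QX : forall j e, j \in I -> e != f -> phi e (alpha j) != 0 -> phi e X = 0.
  apply/(off_alphaP alphaE eta1 alpha_f) => j Ij.
  rewrite phiX mulrA eta1 mul1r vecXE alphaE // dotZBl !dotZ_unitl.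
  have XE k : (vec c + Z) 0 k = vec c 0 k + Z 0 k by rewrite mxE.
  by rewrite !XE Zi0 Zj // /y0 /y; ring.
have := off_alpha_flow alphaE I1 eta1 alpha_f QX; rewrite phiX.
have {}eta1 : `|eta| = 1 by have [->|->] := int_sqr_eq1 eta1.
rewrite normrM eta1 mul1r => flow.
have normX : <<X, X>> = <<c, c>> + (y0 + T) * (y0 + T) - y0 * y0
    - \sum_(j | j \in I) y j * y j.
  rewrite vecXE -/Z dotZDl !dotZDr (dotZC Z) !dotZE.
  have -> : \sum_(j in I) y j * (vec c 0 i0 - vec c 0 j) =
      y0 * T - \sum_(j | j \in I) y j * y j.
    rewrite TE mulr_sumr -sumrB; apply: eq_bigr => j _; rewrite /y0 /y; ring.
  have -> : \sum_(j in I) y j * (Z 0 i0 - Z 0 j) =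
      T * T + \sum_(j | j \in I) y j * y j.
    rewrite {1}TE mulr_suml -big_split; apply: eq_bigr => j Ij /=.
    by rewrite Zi0 Zj //; ring.
  by ring.
(* The right side equals [<<c, c>>] minus the squares of [y0] and of all [y j]; the left side is at
   least [2 * |y0 + T|]. *)
have : \sum_(e | e != f) `|phi e X| <= \sum_(e | e != f) phi e X * phi e X.
  by apply: ler_sum => e _; move: (phi e X) => z; nia.
have := gram X X; rewrite (bigD1 f) //= phiX normX.
have -> : eta * (y0 + T) * (eta * (y0 + T)) = (y0 + T) * (y0 + T).
  by have := int_sqr_eq1 (z := eta); nia.
move: flow; rewrite -/(y _).
set A := \sum_(e | _) _; set B := \sum_(e | _) _; set C := \sum_(e | _) _.
by lia.
Qed.

(** * Shift estimates on the level sets of [sigma] *)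

Definition level (a : int) := [set j | sigma 0 j == a].

Definition level_shift (a : int) (b : M -> int) :=
  (forall c d, b (c - d) = b c - b d) /\
  forall c, \sum_(j in level a) (vec c 0 j + b c) * (vec c 0 j + b c)
    + 2 * `|\sum_(j in level a) (vec c 0 j + b c)| <= <<c, c>>.

Lemma level_shift_exists a : (1 < #|level a|)%N -> exists b, level_shift a b.
Proof.
move=> /card_gt1P[i0 [j1 []]]; rewrite !inE => /eqP s0 /eqP s1 ij.
have [||b bB bP] := @class_estimate i0 j1; rewrite ?s0 ?s1 1?eq_sym //.
exists b; split=> // c; have := bP c; rewrite s0.
have levelE F : \sum_(j in level a) F j = \sum_(j | sigma 0%R j == a) F j :> int.
  by apply: eq_bigl => j; rewrite inE.
by rewrite !levelE.
Qed.

Lemma level_shiftD a b c d : level_shift a b -> b (c + d) = b c + b d.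
Proof.
move=> [bB _]; have b0 : b 0 = 0 by rewrite -(subrr 0) bB subrr.
by rewrite -[d in LHS]opprK bB -[- d]sub0r bB b0 sub0r opprK.
Qed.

Lemma level_shift_pattern a b (Q : {set 'I_r}) (h : int) c :
  level_shift a b -> Q \subset level a ->
  (forall j, j \in level a -> vec c 0 j = - (h * (j \in Q)%:R)) ->
  #|Q|%:Z * ((b c - h) * (b c - h)) + (#|level a|%:Z - #|Q|%:Z) * (b c * b c)
    + 2 * `|#|level a|%:Z * b c - #|Q|%:Z * h| <= <<c, c>>.
Proof.
move=> [_ /(_ c)] + QL cE.
pose g (x : bool) : int := b c - h * x%:R.
rewrite (eq_bigr (fun j => g (j \in Q) * g (j \in Q))) => [|j jL]; last first.
  by rewrite cE // /g; ring.
rewrite [in X in `|X|](eq_bigr (fun j => g (j \in Q))) => [|j jL]; last first.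
  by rewrite cE // /g; ring.
rewrite (sum_mem_subset (fun x => g x * g x)) // (sum_mem_subset g) //.
rewrite /g mulr1 mulr0 subr0; congr (_ + 2 * `|_| <= _); ring.
Qed.

(** The vector [e_t - chi Q] is orthogonal to [sigma] and has norm [1 + #|Q|]; as [t] lies outside
    the level, only [Q] contributes coordinates there. *)
Lemma level_shift_relation a b t (Q : {set 'I_r}) :
  level_shift a b -> t \notin Q -> sigma 0 t != a ->
  sigma 0 t = \sum_(j in Q) sigma 0 j ->
  exists2 c, vec c = unitv t - chi Q &
  #|Q :&: level a|%:Z * ((b c - 1) * (b c - 1))
    + (#|level a|%:Z - #|Q :&: level a|%:Z) * (b c * b c)
    + 2 * `|#|level a|%:Z * b c - #|Q :&: level a|%:Z| <= 1 + #|Q|%:Z.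
Proof.
move=> bP tQ ta tE; have [|c cE] := vec_onto (x := unitv t - chi Q).
  by rewrite dotZBl dotZ_unitl dotZ_chil tE subrr.
exists c => //.
have -> : 1 + #|Q|%:Z = <<c, c>>.
  rewrite cE dotZBl !dotZBr !dotZ_unitl (dotZC (chi Q)) !dotZ_unitl !dotZ_chil.
  rewrite unitvE eqxx chiE (negbTE tQ) subr0 sub0r opprK; congr (_ + _).
  by rewrite (eq_bigr (fun => 1)) => [|j jQ]; rewrite ?sumr_const ?natz ?chiE ?jQ.
have := @level_shift_pattern a b (Q :&: level a) 1 c bP (subsetIr _ _).
rewrite mulr1; apply=> j jL; rewrite cE mxE [X in _ + X]mxE unitvE chiE inE jL andbT.
rewrite mul1r; case: eqP => [tj|_]; last by rewrite sub0r.
by move: jL; rewrite inE -tj (negbTE ta).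
Qed.

(** [pattern_bound] with [N = 1 + #|Q|]: the strict inequality assumed is what excludes shifts
    [b <= 0]. *)
Lemma level_card_bound a t (Q : {set 'I_r}) :
  (1 < #|level a|)%N -> t \notin Q -> sigma 0 t != a ->
  sigma 0 t = \sum_(j in Q) sigma 0 j ->
  (0 < #|Q :&: level a|)%N -> (1 + #|Q| < 3 * #|Q :&: level a|)%N ->
  (3 * #|level a| <= 3 * #|Q :&: level a| + 1 + #|Q|)%N.
Proof.
move=> La tQ ta tE q0 qQ; have [b bP] := level_shift_exists La.
have [c _ H] := level_shift_relation bP tQ ta tE.
have qL : (#|Q :&: level a| <= #|level a|)%N by rewrite subset_leq_card ?subsetIr.
have := @pattern_bound #|Q :&: level a|%:Z #|level a|%:Z (b c) (1 + #|Q|%:Z).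
by move=> /(_ _ _ H); lia.
Qed.

Lemma sum_sigma_level a (Q : {set 'I_r}) :
  Q \subset level a -> \sum_(j in Q) sigma 0 j = #|Q|%:Z * a.
Proof.
move=> /subsetP QL; rewrite (eq_bigr (fun => a)) => [|j /QL]; last by rewrite inE => /eqP.
by rewrite sumr_const -mulr_natl natz.
Qed.

Lemma neq_sigma i j : sigma 0 i != sigma 0 j -> (i == j) = false.
Proof. by apply: contraNF => /eqP->. Qed.

(** Any [k] entries of the level serve as [Q], so the bound becomes [3 * k + 1 + k]. *)
Lemma level_card_uniform a t k : (1 < #|level a|)%N -> sigma 0 t != a ->
  sigma 0 t = k%:Z * a -> (0 < k <= #|level a|)%N -> (3 * #|level a| <= 4 * k + 1)%N.
Proof.
move=> La ta tE /andP[k0 kL]; have [Q QL Qk] := exists_subset_card kL.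
have QLE := setIidPl QL.
have := @level_card_bound a t Q La; rewrite QLE (sum_sigma_level QL) Qk => /(_ _ ta tE).
have tQ : t \notin Q by apply: contra ta => /(subsetP QL); rewrite inE.
by move=> /(_ tQ); lia.
Qed.

(** * The levels 1 and 2 when the value 3 occurs *)

Section LastCoordinateThree.
Variables (t i1 : 'I_r).
Hypotheses (t3 : sigma 0 t = 3) (i1E : sigma 0 i1 = 1).

(* If [#|level 2| >= 3], the relations [e_t - e_i1 - e_i2] and [2 e_i1 - e_i2]
   both have shift 0, and their sum has norm 6 < 8. *)
Lemma level2_le2 : (#|level 2| <= 2)%N.
Proof.
rewrite leqNgt; apply/negP => L2; have L2' : (1 < #|level 2|)%N by lia.
have [b bP] := level_shift_exists L2'.
have [i2 i2L] : exists i, i \in level 2 by apply/card_gt0P; lia.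
have i2E : sigma 0 i2 = 2 by move: i2L; rewrite inE => /eqP.
have t1 : (t == i1) = false by rewrite neq_sigma ?t3 ?i1E.
have t2 : (t == i2) = false by rewrite neq_sigma ?t3 ?i2E.
have i12 : (i1 == i2) = false by rewrite neq_sigma ?i2E ?i1E.
have sub2 : [set i2] \subset level 2 by rewrite sub1set.
(* The bound 5 is the norm of [2 e_i1 - e_i2]; it also covers the other relation, of norm 3. *)
have shift0 (z : int) : ((z - 1) * (z - 1)) + (#|level 2|%:Z - 1) * (z * z)
    + 2 * `|#|level 2|%:Z * z - 1| <= 5 -> z = 0.
  move: #|level 2| L2 => p p3; have [z0|z0|//] := ltgtP z 0.
    have : 2 * 1 <= (p%:Z - 1) * (z * z) by apply: ler_pM; [|by []|lia|nia].
    by nia.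
  have : 2 * 1 <= (p%:Z - 1) * (z * z) by apply: ler_pM; [|by []|lia|nia].
  have : 3 * 1 <= p%:Z * z by apply: ler_pM; [|by []|lia|lia].
  have : 0 <= (z - 1) * (z - 1) by rewrite -expr2 sqr_ge0.
  by lia.
have [|||x xE Hx] := @level_shift_relation 2 b t [set i1; i2] bP.
- by rewrite !inE t1 t2.
- by rewrite t3.
- by rewrite big_setU1 ?inE ?i12 //= big_set1 t3 i1E i2E.
have I2 : [set i1; i2] :&: level 2 = [set i2].
  apply/setP => j; rewrite !inE; have [->|_] := eqVneq j i1.
    by rewrite i1E i12.
  by have [->|] := eqVneq j i2; rewrite ?i2E.
rewrite chi_set2 ?i12 // in xE.
have bx : b x = 0.
  apply: shift0; move: Hx; rewrite I2 cards1 cards2 i12 mul1r.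
  by set A := (_ + _) + _; lia.
have [|y yE] := vec_onto (x := 2 *: unitv i1 - unitv i2).
  by rewrite dotZBl dotZZl !dotZ_unitl i1E i2E.
have dotE := (dotZBl, dotZBr, dotZDl, dotZDr, dotZZl, dotZZr).
have delta2 j : j \in level 2 -> (t == j) = false /\ (i1 == j) = false.
  by rewrite inE => /eqP jE; split; apply: neq_sigma; rewrite ?t3 ?i1E jE.
have by0 : b y = 0.
  apply: shift0; have := level_shift_pattern (Q := [set i2]) (h := 1) (c := y) bP sub2.
  rewrite cards1 mul1r mulr1; have -> : <<y, y>> = 5.
    by rewrite yE !dotE !dotZ_unit !eqxx (eq_sym i2) i12.
  apply=> j /delta2[_ j1].
  by rewrite yE !mxE eqxx /= !(eq_sym j) j1 mulr0 sub0r mul1r inE (eq_sym j).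
(* The sum is [e_t + e_i1 - 2 e_i2]; at shift 0 the left side is 4 + 4. *)
have := level_shift_pattern (Q := [set i2]) (h := 2) (c := x + y) bP sub2.
rewrite cards1 mul1r (level_shiftD _ _ bP) bx by0 addr0.
have -> : <<x + y, x + y>> = 6.
  rewrite raddfD /= xE yE !dotE !dotZ_unit !eqxx !(eq_sym i2).
  by rewrite !(eq_sym i1 t) t1 t2 i12.
have patt j : j \in level 2 -> vec (x + y) 0 j = - (2 * (j \in [set i2])%:R).
  move=> /delta2[jt j1]; rewrite raddfD /= xE yE !mxE eqxx /= !(eq_sym j) jt j1.
  by rewrite inE (eq_sym j); case: (i2 == j).
by move=> /(_ patt); rewrite !mulr0; lia.
Qed.

(* Excludes three 1s and two 2s: the shifts of [e_t - e_i1 - e_i2] and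
   [e_k2 - e_i1 - e_k1] are 0 and 1, and their difference has norm 4 < 6. *)
Lemma level12_le4 : (#|level 1| <= 3)%N -> (#|level 1| + #|level 2| <= 4)%N.
Proof.
have le2 := level2_le2; have [//|gt4] := leqP (#|level 1| + #|level 2|)%N 4 => le3.
have m3 : #|level 1| = 3%N by lia.
have p2 : (1 < #|level 2|)%N by lia.
have [b bP] : exists b, level_shift 1 b by apply: level_shift_exists; rewrite m3.
have [k1 k1L k1i] : exists2 k, k \in level 1 & k != i1.
  have : (1 < #|level 1|)%N by rewrite m3.
  move=> /card_gt1P[k [k' [kL kL' kk]]].
  have [ki|ki] := eqVneq k i1; last by exists k.
  by exists k'; rewrite // -ki eq_sym.
have /card_gt1P[i2 [k2 [i2L k2L ik2]]] := p2.
have [i2E k2E k1E] : [/\ sigma 0 i2 = 2, sigma 0 k2 = 2 & sigma 0 k1 = 1].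
  by move: i2L k2L k1L; rewrite !inE => /eqP-> /eqP-> /eqP->.
have t1 : (t == i1) = false by rewrite neq_sigma ?t3 ?i1E.
have tk1 : (t == k1) = false by rewrite neq_sigma ?t3 ?k1E.
have t2 : (t == i2) = false by rewrite neq_sigma ?t3 ?i2E.
have tk2 : (t == k2) = false by rewrite neq_sigma ?t3 ?k2E.
have i12 : (i1 == i2) = false by rewrite neq_sigma ?i2E ?i1E.
have ik12 : (i1 == k2) = false by rewrite neq_sigma ?k2E ?i1E.
have ki12 : (k1 == i2) = false by rewrite neq_sigma ?i2E ?k1E.
have k12 : (k1 == k2) = false by rewrite neq_sigma ?k2E ?k1E.
have i1k1 : (i1 == k1) = false by rewrite eq_sym (negbTE k1i).
have [|||x xE Hx] := @level_shift_relation 1 b t [set i1; i2] bP.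
- by rewrite !inE t1 t2.
- by rewrite t3.
- by rewrite big_setU1 ?inE ?i12 //= big_set1 t3 i1E i2E.
have [|||y yE Hy] := @level_shift_relation 1 b k2 [set i1; k1] bP.
- by rewrite !inE !(eq_sym k2) ik12 k12.
- by rewrite k2E.
- by rewrite big_setU1 ?inE ?i1k1 //= big_set1 k2E i1E k1E.
have I1 : [set i1; i2] :&: level 1 = [set i1].
  apply/setP => j; rewrite !inE; have [->|_] := eqVneq j i1; first by rewrite i1E.
  by have [->|] := eqVneq j i2; rewrite ?i2E.
have I2 : [set i1; k1] :&: level 1 = [set i1; k1].
  by apply/setIidPl/subsetP => j; rewrite !inE => /orP[]/eqP->; rewrite ?i1E ?k1E.
rewrite chi_set2 ?i12 // in xE; rewrite chi_set2 ?i1k1 // in yE.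
have bx : b x = 0.
  by apply: shift3_one; move: Hx; rewrite I1 cards1 cards2 i12 m3.
have by1 : b y = 1.
  by apply: shift3_two; move: Hy; rewrite I2 cards2 i1k1 m3.
have [bB _] := bP.
(* The difference is [e_k2 + e_i2 - e_k1 - e_t]; at shift 1 the left side is 0 + 2 + 4. *)
have := level_shift_pattern (Q := [set k1]) (h := 1) (c := y - x) bP.
rewrite sub1set cards1 m3 bB bx by1 => /(_ k1L).
have -> : <<y - x, y - x>> = 4.
  rewrite raddfB /= xE yE !(dotZBl, dotZBr, dotZDl, dotZDr) !dotZ_unit !eqxx.
  rewrite !(eq_sym k2) !(eq_sym i2) !(eq_sym _ t) !(eq_sym k1 i1).
  by rewrite t1 tk1 t2 tk2 i12 ik12 ki12 k12 i1k1 (eq_sym k2) (negbTE ik2).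
have patt j : j \in level 1 -> vec (y - x) 0 j = - (1 * (j \in [set k1])%:R).
  move=> jL; have {jL} jE : sigma 0 j = 1 by move: jL; rewrite inE => /eqP.
  rewrite raddfB /= xE yE !mxE eqxx /= !inE !(eq_sym j).
  rewrite (neq_sigma (i := t)) ?t3 ?jE // (neq_sigma (i := i2)) ?i2E ?jE //.
  rewrite (neq_sigma (i := k2)) ?k2E ?jE //.
  by case: (i1 == j); case: (k1 == j).
by move=> /(_ patt).
Qed.

End LastCoordinateThree.

(** * Counting the entries 1 and 2 *)

Lemma level1_le3 i2 : sigma 0 i2 = 2 -> (#|level 1| <= 3)%N.
Proof.
move=> i2E; have [|m2] := leqP #|level 1| 1; first by lia.
by have := @level_card_uniform 1 i2 2 m2; rewrite i2E => /(_ isT erefl); lia.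
Qed.

(** If there are enough 1s, or enough 2s, [sigma_t] is a sum of them, with one extra 1 for an odd
    value and 2s; this bounds their number. Otherwise the counts are small already. *)
Lemma level12_card t i1 : 3 <= sigma 0 t -> sigma 0 i1 = 1 ->
  2 * (#|level 1|%:Z + #|level 2|%:Z) <= 8 + sigma 0 t * (sigma 0 t - 3).
Proof.
move=> + i1E; case st : (sigma 0 t) => [s|s]; last by lia.
have ta a : a < 3 -> 3 <= Posz s -> sigma 0 t != a by rewrite st; lia.
move=> s3.
have [p0|[i2 i2L]] := set_0Vmem (level 2).
  rewrite p0 cards0; have [ms|sm] := ltnP #|level 1| s; first by nia.
  have := @level_card_uniform 1 t s; rewrite st mulr1.
  have -> : (1 < #|level 1|)%N by lia.
  move=> /(_ isT) H; have {H} : (3 * #|level 1| <= 4 * s + 1)%N.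
    by apply: H => //; lia.
  by have [->|] := eqVneq s 3%N; [lia | nia].
have m3 : (#|level 1| <= 3)%N by apply: (@level1_le3 i2); move: i2L; rewrite inE => /eqP.
have [s3'|s3'] := eqVneq s 3%N.
  by have := @level12_le4 t i1; rewrite st s3' => /(_ erefl i1E m3); lia.
have [p1|p1] := leqP #|level 2| 1; first by nia.
(* Here [s >= 4] and there are at most three 1s, so this bound suffices. *)
suff : (3 * #|level 2| <= 2 * s + 1)%N.
  by have [->|] := eqVneq s 4%N; [lia | nia].
have sE := odd_double_half s; have [ps|sp] := ltnP #|level 2| s./2; first by lia.
have [odds|evens] := boolP (odd s); rewrite ?odds ?(negbTE evens) in sE; last first.
  have := @level_card_uniform 2 t s./2 p1; rewrite st => H.
  have {H} : (3 * #|level 2| <= 4 * s./2 + 1)%N by apply: H; lia.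
  by lia.
(* For odd [s] the relation uses [s./2] twos and [i1]; since [s >= 5], [s./2 >= 2] and
   [level_card_bound] applies. *)
have [Q QL Qs] := exists_subset_card sp.
have i1Q : i1 \notin Q by apply/negP => /(subsetP QL); rewrite inE i1E.
have tL a : a < 3 -> t \notin level a by move=> a3; rewrite inE ta.
have I2 : (i1 |: Q) :&: level 2 = Q.
  rewrite setIUl (setIidPl QL) (_ : _ :&: _ = set0) ?set0U //.
  by apply/setP => j; rewrite !inE; case: eqP => // ->; rewrite i1E.
have := @level_card_bound 2 t (i1 |: Q) p1; rewrite I2 cardsU1 i1Q Qs => H.
have {H} : (3 * #|level 2| <= 3 * s./2 + 1 + (1 + s./2))%N.
  apply: H; [|exact: ta| |by lia|by lia].
    rewrite in_setU1 negb_or; apply/andP; split.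
      by apply: contraL s3 => /eqP t1; move: st; rewrite t1 i1E => -[<-].
    by apply: contra (tL 2 isT) => /(subsetP QL).
  by rewrite big_setU1 //= i1E (sum_sigma_level QL) Qs st; lia.
by lia.
Qed.

Lemma sum_sigma_bound t i1 : 3 <= sigma 0 t -> sigma 0 i1 = 1 ->
  0 <= 8 + \sum_i sigma 0 i * (sigma 0 i - 3).
Proof.
move=> t3 i1E; have := level12_card t3 i1E.
have level_sum a : #|level a|%:Z = \sum_i (sigma 0 i == a)%:R.
  rewrite -natz -sumr_const big_mkcond; apply: eq_bigr => i _.
  by rewrite inE; case: ifP.
(* The correction cancels the value -2 of [z * (z - 3)] at 1 and 2, leaving nonnegative terms, of
   which only the one at [t] is kept. *)
pose g i := sigma 0 i * (sigma 0 i - 3) + 2 * ((sigma 0 i == 1)%:R + (sigma 0 i == 2)%:R).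
have g_ge0 i : 0 <= g i.
  have := sigma_gt0 i; rewrite /g; case: eqP => [->//|]; case: eqP => [->//|]; nia.
have : sigma 0 t * (sigma 0 t - 3) <= \sum_i g i.
  apply: (@le_trans _ _ (g t)); last by rewrite (bigD1 t) //= lerDl sumr_ge0.
  by rewrite /g lerDl; do 2 case: eqP => _.
rewrite big_split /= -mulr_sumr big_split /= -!level_sum.
by move: (\sum_i _ : int) (#|_|%:Z + _) (sigma 0 t * _) => x y z; lia.
Qed.

End Network.

(** * The graph of an obtuse superbase *)

Section Graph.
Variables (r k : nat) (v : 'I_k.+1 -> 'rV[int]_r).

(** Restricting to [p.1 < p.2] counts each unordered pair once and excludes loops. For an obtuse
    family the absolute value is the negated pairing. *)
Definition mult (p : 'I_k.+1 * 'I_k.+1) : nat :=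
  if (p.1 < p.2)%N then `|dotZ (v p.1) (v p.2)|%N else 0%N.

(* [mult p] parallel edges for each pair. *)
Definition edge : finType := {p : 'I_k.+1 * 'I_k.+1 & 'I_(mult p)}.

Definition combine (c : 'rV[int]_k.+1) : 'rV[int]_r := \sum_i c 0 i *: v i.

Lemma combine_is_zmod_morphism : zmod_morphism combine.
Proof.
move=> c d; rewrite /combine -sumrB; apply: eq_bigr => i _.
by rewrite !mxE scalerBl.
Qed.

HB.instance Definition _ :=
  GRing.isZmodMorphism.Build _ _ combine combine_is_zmod_morphism.

Definition tension (e : edge) (c : 'rV[int]_k.+1) : int :=
  c 0 (tag e).1 - c 0 (tag e).2.

Lemma tension_is_zmod_morphism e : zmod_morphism (tension e).
Proof. by move=> c d; rewrite /tension !mxE; ring. Qed.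

HB.instance Definition _ e :=
  GRing.isZmodMorphism.Build _ _ (tension e) (tension_is_zmod_morphism e).

(** [u] is the indicator of the superlevel set of [c] at its value on the first end of [f]; the
    second end lies strictly below, and every crossing edge has its higher potential inside the
    set. *)
Lemma tension_threshold f c : 0 < tension f c -> exists2 u, tension f u = 1 &
  forall e, [\/ tension e u = 0, tension e u = 1 /\ 0 < tension e c
    | tension e u = -1 /\ tension e c < 0].
Proof.
rewrite /tension subr_gt0 => fc.
exists (\row_i (c 0 (tag f).1 <= c 0 i)%R%:R) => [|e].
  by rewrite !mxE lexx leNgt fc.
rewrite !mxE subr_gt0 subr_lt0; set h := c 0 (tag f).1.
have [h1|h1] := lerP h (c 0 (tag e).1); have [h2|h2] := lerP h (c 0 (tag e).2).
- by constructor 1.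
- by constructor 2; split=> //; apply: lt_le_trans h1.
- by constructor 3; split=> //; apply: lt_le_trans h2.
- by constructor 1.
Qed.

Hypothesis obtuse : forall i j, i != j -> dotZ (v i) (v j) <= 0.
Hypothesis sum_v : \sum_i v i = 0.

(* As the rows of the Gram matrix [g] sum to 0, both sides equal
   [- 1/2 * \sum_(i, j) g i j * (c i - c j) * (d i - d j)]. *)
Lemma gram_tension c d :
  dotZ (combine c) (combine d) = \sum_(e : edge) tension e c * tension e d.
Proof.
pose F i j := (c 0 i - c 0 j) * (d 0 i - d 0 j).
pose g i j := dotZ (v i) (v j).
have gC i j : g i j = g j i by rewrite /g dotZC.
have g_row i : \sum_j g i j = 0.
  by rewrite -dotZ_sumr sum_v /dotZ big1 // => j _; rewrite mxE mulr0.
have -> : \sum_(e : edge) tension e c * tension e d =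
    \sum_(i < k.+1) \sum_(j < k.+1 | (i < j)%N) - (g i j * F i j).
  rewrite pair_big_dep /=.
  transitivity (\sum_(p : 'I_k.+1 * 'I_k.+1) \sum_(l < mult p) F p.1 p.2).
    by rewrite sig_big_dep.
  rewrite [RHS]big_mkcond; apply: eq_bigr => -[i j] _ /=.
  rewrite sumr_const card_ord /mult /=; case: ifP => [ij|_]; last by rewrite mulr0n.
  rewrite -mulr_natl natz abszE ler0_norm ?mulNr //.
  by apply: obtuse; rewrite neq_ltn ij.
have -> : dotZ (combine c) (combine d) = \sum_i \sum_j g i j * (c 0 i * d 0 j).
  rewrite dotZ_suml; apply: eq_bigr => i _.
  rewrite dotZ_sumr; apply: eq_bigr => j _.
  by rewrite dotZZl dotZZr /g; ring.
(* [F] is symmetric and vanishes on the diagonal. *)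
have half : \sum_i \sum_j g i j * F i j =
    2 * \sum_(i < k.+1) \sum_(j < k.+1 | (i < j)%N) g i j * F i j.
  have -> : \sum_i \sum_j g i j * F i j = \sum_(i < k.+1) (\sum_(j < k.+1 | (i < j)%N) g i j * F i j
      + \sum_(j < k.+1 | (j < i)%N) g i j * F i j).
    apply: eq_bigr => i _; rewrite (bigID (fun j : 'I_k.+1 => (i < j)%N)) /=; congr (_ + _).
    rewrite (bigID (fun j => j == i)) /= big1 ?add0r => [|j /andP[_ /eqP->]]; last first.
      by rewrite /F subrr mul0r mulr0.
    by apply: eq_bigl => j; rewrite -leqNgt ltn_neqAle andbC.
  rewrite big_split /= [X in _ + X](exchange_big_dep xpredT) //=.
  rewrite mulrDl mul1r; congr (_ + _); apply: eq_bigr => i _; apply: eq_bigr => j _.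
  by rewrite gC /F; ring.
(* The terms in [c_i d_i] and [c_j d_j] vanish because rows and columns of [g] sum to 0. *)
have expand : \sum_i \sum_j g i j * F i j = - 2 * \sum_i \sum_j g i j * (c 0 i * d 0 j).
  have -> : \sum_i \sum_j g i j * F i j =
      \sum_i \sum_j (g i j * (c 0 i * d 0 i) + g i j * (c 0 j * d 0 j)
        - (g i j * (c 0 i * d 0 j) + g j i * (c 0 j * d 0 i))).
    by apply: eq_bigr => i _; apply: eq_bigr => j _; rewrite (gC j) /F; ring.
  have diag0 (h : 'I_k.+1 -> int) : \sum_i \sum_j g i j * h i = 0.
    by rewrite big1 // => i _; rewrite -mulr_suml g_row mul0r.
  have diag0' (h : 'I_k.+1 -> int) : \sum_i \sum_j g i j * h j = 0.
    rewrite exchange_big /= -[RHS](diag0 h).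
    by apply: eq_bigr => i _; apply: eq_bigr => j _; rewrite gC.
  under eq_bigr do rewrite sumrB !big_split /=.
  rewrite sumrB !big_split /= diag0 diag0' [X in _ - (_ + X)]exchange_big /=.
  by ring.
apply: (mulfI (x := -2)) => //; rewrite -expand half.
under [X in _ = _ * X]eq_bigr do rewrite sumrN.
by rewrite sumrN mulNr mulrN opprK.
Qed.

End Graph.

(** * From the superbase to the bound on the norm of [sigma] *)

Unset Implicit Arguments.

Theorem theorem6p1 (r : nat) (sigma : 'rV[int]_r) :
  changemaker sigma ->
  (forall i : 'I_r, val i = r.-1 -> 3 <= sigma 0 i) ->
  admits_obtuse_superbase (cm_lattice sigma) r.-1 ->
  ((dotZ sigma sigma)%:~R : rat)
    <= 4 + 3%:R / 2%:R * \sum_(i < r) ((sigma 0 i * (sigma 0 i - 1))%:~R : rat).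
Proof.
move=> [r_gt0 [first_eq1 step]] last_ge3 [v [vL [v_span [obtuse sum_v]]]].
pose i1 := Ordinal r_gt0.
have t_lt : (r.-1 < r)%N by rewrite prednK.
have sigma_gt0 i : 0 < sigma 0 i.
  case: i => n; elim: n => [|n IH] lt_n; first by rewrite first_eq1.
  have lt_n' := ltn_trans (ltnSn n) lt_n.
  have [le_n _] := step (Ordinal lt_n') (Ordinal lt_n) erefl.
  exact: lt_le_trans (IH lt_n') le_n.
have orth c : dotZ (combine v c) sigma = 0.
  by rewrite dotZ_suml big1 // => i _; rewrite dotZZl vL mulr0.
have onto x : dotZ x sigma = 0 -> exists c, combine v c = x.
  move=> /v_span[c ->]; exists (\row_i c i).
  by apply: eq_bigr => i _; rewrite mxE.
have := sum_sigma_bound (vec := combine v) (phi := @tension r r.-1 v) sigma_gt0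
  orth onto (gram_tension obtuse sum_v) (@tension_threshold r r.-1 v)
  (last_ge3 (Ordinal t_lt) erefl) (first_eq1 i1 erefl).
rewrite -raddf_sum /=.
(* With [S] the sum of [z * (z - 1)] and [n] the norm, this turns the bound into
   [2 * n <= 8 + 3 * S]. *)
have -> : \sum_i sigma 0 i * (sigma 0 i - 3) = \sum_i
  (3 * (sigma 0 i * (sigma 0 i - 1)) - 2 * (sigma 0 i * sigma 0 i)).
  by apply: eq_bigr => i _; ring.
rewrite sumrB -!mulr_sumr -/(dotZ sigma sigma).
move: (\sum_i _) (dotZ _ _) => S n; rewrite -(ler_int rat) => H.
have {H} : 0 <= 8 + (3 * S%:~R - 2 * n%:~R) :> rat.
  by move: H; rewrite !(rmorphD, rmorphN, rmorphM).
by lra.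
Qed.
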